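(* Let $n\ge 2$ be an integer, $0<a\le 1$, $p,q\ge 1$ and $r>0$ satisfy $$\frac1r\ge\frac ap+\frac{1-a}{q}-\frac an .$$ Then $$\inf_{0\not\equiv u\in C_0^\infty(\mathbb{R}^n\setminus\{0\})}\frac{\left(\int_{\mathbb{R}^n}|x|^{p-n}|\nabla u(x)|^p\,dx\right)^{\frac ap}\left(\int_{\mathbb{R}^n}|x|^{-n}|u(x)|^q\,dx\right)^{\frac{1-a}{q}}}{\left(\int_{\mathbb{R}^n}|x|^{-n}|u(x)|^r\,dx\right)^{\frac1r}}=0 .$$
   Context: $C_0^\infty(\Omega)$ denotes the smooth functions with compact support in $\Omega$. When $a=1$ the factor with exponent $\frac{1-a}{q}=0$ is understood to be $1$. *)

(* Defs.v *)
From HB Require Import structures.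
From mathcomp Require Import all_boot all_order all_algebra.
From mathcomp Require Import all_classical all_reals all_analysis.

Set Implicit Arguments.
Unset Strict Implicit.
Unset Printing Implicit Defensive.

Import Order.TTheory GRing.Theory Num.Theory.
Import numFieldTopology.Exports numFieldNormedType.Exports.

Local Open Scope classical_set_scope.
Local Open Scope ring_scope.

(* The product sigma-algebra on matrices, generated by the entries; on
   'rV[R]_n this is the Borel sigma-algebra of R^n. *)
Definition measure_matrix_display : measure_display -> measure_display.
Proof. exact. Qed.

Section measurable_matrix.
Context d (T : sigmaRingType d) (m n : nat).

Definition matrix_measurable : set (set 'M[T]_(m, n)) :=
  <<s \bigcup_(ij in [set: 'I_m * 'I_n])
        preimage_set_system setT (fun M : 'M[T]_(m, n) => M ij.1 ij.2)
          measurable >>.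

Let matrix_set0 : matrix_measurable set0.
Proof. exact: sigma_algebra0. Qed.

Let matrix_setC A : matrix_measurable A -> matrix_measurable (~` A).
Proof. exact: sigma_algebraC. Qed.

Let matrix_bigcup (F : (set 'M[T]_(m, n))^nat) :
  (forall i, matrix_measurable (F i)) -> matrix_measurable (\bigcup_i F i).
Proof. exact: sigma_algebra_bigcup. Qed.

HB.instance Definition _ := @isMeasurable.Build (measure_matrix_display d)
  'M[T]_(m, n) matrix_measurable matrix_set0 matrix_setC matrix_bigcup.

End measurable_matrix.

Lemma measurable_fun_entry d (T : measurableType d) (m n : nat) i j :
  measurable_fun setT (fun M : 'M[T]_(m, n) => M i j).
Proof.
move=> _ A mA; rewrite setTI; apply: sub_sigma_algebra.
by exists (i, j) => //; exists A => //; rewrite setTI.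
Qed.

Lemma measurable_fun_matrix d d' (S : measurableType d) (T : measurableType d')
    (m n : nat) (f : S -> 'M[T]_(m, n)) :
  (forall i j, measurable_fun setT (fun s => f s i j)) ->
  measurable_fun setT f.
Proof.
move=> mf.
apply: (@measurability _ _ _ _ setT f
  (\bigcup_(ij in [set: 'I_m * 'I_n])
        preimage_set_system setT (fun M : 'M[T]_(m, n) => M ij.1 ij.2)
          measurable)) => //.
move=> _ [_ [[i j] _ [A mA <-]] <-]; rewrite /= setTI.
exact: (mf i j measurableT A mA).
Qed.

Section lebesgue_measure_rV.
Variable R : realType.

Definition rV_cons n (p : R * 'rV[R]_n) : 'rV[R]_n.+1 :=
  row_mx (const_mx p.1 : 'rV[R]_1) p.2.

(* Lebesgue measure on R^n as the n-fold product of the one on R: the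
   identification of R * R^n with R^n.+1 is rV_cons, and R^0 is a point of
   mass 1. *)
Fixpoint lebesgue_rV n : set 'rV[R]_n -> \bar R :=
  match n with
  | 0 => dirac (0 : 'rV[R]_0)
  | m.+1 => pushforward (lebesgue_measure \x @lebesgue_rV m)%E (@rV_cons m)
  end.

Lemma rV_consE0 n (p : R * 'rV[R]_n) i : rV_cons p i ord0 = p.1.
Proof.
rewrite /rV_cons mxE; case: splitP => /= j ; last by [].
by rewrite mxE.
Qed.

Lemma rV_consES n (p : R * 'rV[R]_n) i (j : 'I_n) :
  rV_cons p i (lift ord0 j) = p.2 0 j.
Proof.
rewrite /rV_cons mxE; case: splitP => /= k; first by case: k => -[].
by rewrite /bump/= => -[/ord_inj ->]; rewrite ord1.
Qed.

Lemma measurable_rV_cons n : measurable_fun setT (@rV_cons n).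
Proof.
apply: measurable_fun_matrix => i j; case: (unliftP ord0 j) => [k|] ->.
  rewrite (_ : (fun s => _) = (fun M : 'rV[R]_n => M 0 k) \o snd); last first.
    by apply/funext => s /=; rewrite rV_consES.
  by apply: measurableT_comp => //; exact: measurable_fun_entry.
rewrite (_ : (fun s => _) = fst); first exact: measurable_fst.
by apply/funext => s; rewrite rV_consE0.
Qed.

Section step.
Variables (n : nat) (mu : {sigma_finite_measure set 'rV[R]_n -> \bar R}).

Let nu : {measure set _ -> \bar R} :=
  (lebesgue_measure \x mu)%E.

Let push : {measure set 'rV[R]_n.+1 -> \bar R} :=
  measure_function_pushforward__canonical__measure_function_Measure
    nu (@measurable_rV_cons n).

Let step := pushforward nu (@rV_cons n).

HB.instance Definition _ := isMeasure.Build _ _ _ step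
  (measure0 push) (measure_ge0 push) (@measure_semi_sigma_additive _ _ _ push).

Let step_sigma_finite : sigma_finite setT step.
Proof.
have /sigma_finiteP[F [FT ndF mF]] := sigma_finiteT (@lebesgue_measure R).
have /sigma_finiteP[G [GT ndG mG]] := sigma_finiteT mu.
pose split_rV (v : 'rV[R]_n.+1) : R * 'rV[R]_n :=
  (v 0 ord0, \row_j v 0 (lift ord0 j)).
have rV_consK : cancel (@rV_cons n) split_rV.
  move=> [x v]; rewrite /split_rV rV_consE0; congr pair.
  by apply/rowP => j; rewrite mxE rV_consES.
have msplit : measurable_fun setT split_rV.
  apply: measurable_fun_pair; first exact: measurable_fun_entry.
  apply: measurable_fun_matrix => i j.
  rewrite (_ : (fun s => _) = (fun M : 'rV[R]_n.+1 => M 0 (lift ord0 j))).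
    exact: measurable_fun_entry.
  by apply/funext => s; rewrite mxE.
exists (fun k => split_rV @^-1` (F k `*` G k)).
  apply/esym; rewrite -subTset => v _.
  have : (\bigcup_k F k) (split_rV v).1 by rewrite -FT.
  have : (\bigcup_k G k) (split_rV v).2 by rewrite -GT.
  move=> [j _ Gj] [i _ Fi]; exists (maxn i j) => //; split.
    by move: Fi; exact/subsetPset/ndF/leq_maxl.
  by move: Gj; exact/subsetPset/ndG/leq_maxr.
move=> k; have [mFk Fk] := mF k; have [mGk Gk] := mG k; split.
  by rewrite -[X in measurable X]setTI; apply: msplit => //; exact: measurableX.
rewrite /step /pushforward -comp_preimage (_ : split_rV \o _ = id); last first.
  by apply/funext => p /=; rewrite rV_consK.
rewrite preimage_id [ltLHS]product_measure1E//.
by rewrite lte_mul_pinfty// ge0_fin_numE.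
Qed.

HB.instance Definition _ := Measure_isSigmaFinite.Build _ _ _ step
  step_sigma_finite.

Definition lebesgue_rV_step : {sigma_finite_measure set 'rV[R]_n.+1 -> \bar R} :=
  step.

End step.

Lemma lebesgue_rV_sigma_finite_measure n :
  exists mu : {sigma_finite_measure set 'rV[R]_n -> \bar R},
    @lebesgue_rV n = mu.
Proof.
elim: n => [|n [mu IH]]; first by exists (dirac (0 : 'rV[R]_0)).
by exists (lebesgue_rV_step mu); rewrite /= IH.
Qed.

Section instance.
Variable n : nat.
Let mu := proj1_sig (cid (lebesgue_rV_sigma_finite_measure n)).
Let muE : @lebesgue_rV n = mu := 
  proj2_sig (cid (lebesgue_rV_sigma_finite_measure n)).

Let lebesgue_rV0 : @lebesgue_rV n set0 = 0%E :> \bar R.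
Proof. by rewrite muE measure0. Qed.

Let lebesgue_rV_ge0 (A : set 'rV[R]_n) : (0 <= lebesgue_rV A)%E.
Proof. by rewrite muE measure_ge0. Qed.

Let lebesgue_rV_sigma_additive : semi_sigma_additive (@lebesgue_rV n).
Proof. by rewrite muE; exact: measure_semi_sigma_additive. Qed.

HB.instance Definition _ := isMeasure.Build _ _ _ (@lebesgue_rV n)
  lebesgue_rV0 lebesgue_rV_ge0 lebesgue_rV_sigma_additive.

Let lebesgue_rV_sigma_finite : sigma_finite setT (@lebesgue_rV n).
Proof. by rewrite muE; exact: sigma_finiteT. Qed.

HB.instance Definition _ := Measure_isSigmaFinite.Build _ _ _ (@lebesgue_rV n)
  lebesgue_rV_sigma_finite.

End instance.

Lemma lebesgue_rV_box n (A : 'I_n -> set R) :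
  (forall i, measurable (A i)) ->
  lebesgue_rV [set x : 'rV[R]_n | forall i, A i (x 0 i)] =
  (\prod_(i < n) lebesgue_measure (A i))%E.
Proof.
elim: n A => [|n IH] A mA.
  by rewrite big_ord0 /= diracE mem_set// => -[].
rewrite big_ord_recl -IH//= /pushforward.
rewrite -product_measure1E//; last first.
  rewrite (_ : mkset _ =
      \bigcap_(i in [set: 'I_n]) [set x : 'rV[R]_n | A (lift ord0 i) (x 0 i)]).
    apply: fin_bigcap_measurable => // i _.
    rewrite -[X in measurable X]setTI.
    exact: (@measurable_fun_entry _ R 1 n 0 i measurableT _ (mA _)).
  by apply/seteqP; split => x xA i; [move=> _; exact: xA|exact: xA].
  exact: (mA ord0).
congr (product_measure1 _ _ _); apply/seteqP; split => -[x v] /=.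
  move=> h; split; first by have := h ord0; rewrite rV_consE0.
  by move=> i; have := h (lift ord0 i); rewrite rV_consES.
move=> [Ax Av] i; case: (unliftP ord0 i) => [j|] ->.
  by rewrite rV_consES; exact: Av.
by rewrite rV_consE0.
Qed.

End lebesgue_measure_rV.
Arguments lebesgue_rV {R} n.

Section smooth_functions.
Variables (R : realType) (n : nat).
Implicit Types (u : 'rV[R]_n -> R) (x : 'rV[R]_n) (i : 'I_n).

Definition enorm x : R := Num.sqrt (\sum_i x 0 i ^+ 2).

Definition partial i u : 'rV[R]_n -> R := fun x => 'D_(delta_mx 0 i) u x.

Definition gradient u x : 'rV[R]_n := \row_i partial i u x.

(* All partial derivatives of all orders exist and are continuous on R^n. *)
Definition smooth u := forall s : seq 'I_n,
  let v := foldr partial u s in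
  continuous v /\ forall i x, derivable v x (delta_mx 0 i).

Definition tsupport u := closure [set x | u x != 0].

(* Elements of C_0^oo(Omega), Omega open, are identified with their extensions
   by 0 to R^n. *)
Definition Cc_infty (Omega : set 'rV[R]_n) : set ('rV[R]_n -> R) :=
  [set u | [/\ smooth u, compact (tsupport u) & tsupport u `<=` Omega]].

(* All powers are those of powR/poweR; the second factor is 1 when a = 1 since
   y `^ 0 = 1 for every y : \bar R. *)
Definition CKN_quotient (a p q r : R) u : \bar R :=
  ((\int[lebesgue_rV n]_x (enorm x `^ (p - n%:R) * enorm (gradient u x) `^ p)%:E)
      `^ (a / p)
   * (\int[lebesgue_rV n]_x (enorm x `^ (- n%:R) * `|u x| `^ q)%:E)
      `^ ((1 - a) / q)
   / (\int[lebesgue_rV n]_x (enorm x `^ (- n%:R) * `|u x| `^ r)%:E)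
      `^ r^-1)%E.

End smooth_functions.

(* Main.v *)
Require Import Defs.
From mathcomp Require Import all_boot all_order all_algebra.
From mathcomp Require Import all_classical all_reals all_analysis.
From mathcomp Require Import measurable_realfun zify ring lra.
Import Order.TTheory GRing.Theory Num.Theory.
Import numFieldTopology.Exports numFieldNormedType.Exports.
Local Open Scope classical_set_scope.
Local Open Scope ring_scope.

Set Implicit Arguments.
Unset Strict Implicit.
Unset Printing Implicit Defensive.

(** The quotient is evaluated on the radial functions
    u_K(x) = phi(log_2 |x| / K), where phi is a fixed bump supported in [1, 4].
    In the logarithmic variable t = ln |x| the measure |x|^{-n} dx becomes a
    multiple of dt and |x| |grad u| becomes |du/dt|, so stretching by K
    multiplies the gradient integral by K^{1-p} and the other two by K.  The
    quotient is thus O(K^E) with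
    E = a/p - a + (1-a)/q - 1/r <= a/n - a < 0.  Instead of polar coordinates,
    the integrals are estimated on dyadic shells by means of cubes. *)

(** * The flat functions t^-k exp(-1/t) and their derivatives *)

Section flat_functions.
Context {R : realType}.
Implicit Types (f : R -> R) (t x : R) (k : nat).

(** The bound forces f 0 = 0 and makes the difference quotient at 0 at most C |h|. This settles the
    gluing point of the flat functions. *)
Lemma is_derive0_quadratic f (C : R) :
  (forall t, `|f t| <= C * t ^+ 2) -> is_derive (0 : R) (1 : R) f 0.
Proof.
move=> fC.
have f0 : f 0 = 0.
  by apply/eqP; rewrite -normr_le0; have := fC 0; rewrite expr0n/= mulr0.
suff H : h^-1 *: ((f \o shift 0) (h *: (1 : R)) - f 0) @[h --> 0^'] --> (0 : R).
  by apply: DeriveDef; [apply/cvg_ex; exists 0|exact: cvg_lim].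
apply/cvgr0Pnorm_le => e e0; near=> h.
have h0 : h != 0 by near: h; exact: nbhs_dnbhs_neq.
rewrite /= addr0 f0 subr0 normrZ [_ *: _]mulr1 normfV.
rewrite ler_pdivrMl ?normr_gt0//.
apply: (le_trans (fC h)); rewrite -real_normK ?num_real// expr2 mulrCA.
apply: ler_wpM2l => //.
have C0 : 0 < `|C| + 1 by rewrite ltr_wpDl.
have he : `|h| <= e / (`|C| + 1).
  near: h; apply: dnbhs0_le; exact: divr_gt0.
move: he; rewrite ler_pdivlMr// => he; apply: le_trans he.
rewrite mulrC ler_wpM2l//; have := ler_norm C; lra.
Unshelve. all: by end_near. Qed.

(** For k = 0 this is the classical smooth function exp(-1/t) extended by 0. The powers of 1/t make
    the span of the family stable under differentiation. *)
Definition flat k t : R := if 0 < t then t^-1 ^+ k * expR (- t^-1) else 0.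

Lemma flat_le0 k t : t <= 0 -> flat k t = 0.
Proof. by move=> t0; rewrite /flat ltNge t0. Qed.

Lemma flat_gt0E k t : 0 < t -> flat k t = t^-1 ^+ k * expR (- t^-1).
Proof. by rewrite /flat => ->. Qed.

Lemma flat_ge0 k t : 0 <= flat k t.
Proof.
rewrite /flat; case: ifPn => // t0.
by rewrite mulr_ge0 ?expR_ge0// exprn_ge0// invr_ge0 ltW.
Qed.

(** With y = 1/t, a single term of the exponential series gives y^(k+2) <= (k+2)! e^y; divide by y^2
    e^y. *)
Lemma flat_quadratic k t : `|flat k t| <= (k.+2)`!%:R * t ^+ 2.
Proof.
rewrite ger0_norm ?flat_ge0// /flat; case: ifPn => [t0|_]; last first.
  by rewrite mulr_ge0// sqr_ge0.
have y0 : 0 < t^-1 by rewrite invr_gt0.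
have fac0 : 0 < (k.+2)`!%:R :> R by rewrite ltr0n fact_gt0.
have := @expR_ge1Dxn R t^-1 k.+1 (ltW y0) => H.
have {H}H : t^-1 ^+ k.+2 <= (k.+2)`!%:R * expR t^-1.
  by rewrite mulrC -ler_pdivrMr//; apply: le_trans H; rewrite lerDr.
rewrite expRN ler_pdivrMr ?expR_gt0//.
rewrite mulrAC -ler_pdivrMr ?exprn_gt0//.
by rewrite -exprVn -exprD addn2.
Qed.

(** Away from 0 the function agrees locally with 0 or with the explicit product. At 0 the quadratic
    bound gives derivative 0, which is also the value of the formula there. *)
Lemma is_derive_flat k t :
  is_derive t (1 : R) (flat k) (flat k.+2 t - k%:R * flat k.+1 t).
Proof.
have [t0|t0|->] := ltgtP t 0.
- rewrite (flat_le0 k.+2 (ltW t0)) (flat_le0 k.+1 (ltW t0)) mulr0 subr0.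
  apply: (near_eq_is_derive (f := cst 0)).
  near=> s; rewrite flat_le0//; apply: ltW; near: s; exact: lt_nbhsl.
- rewrite (flat_gt0E k.+2 t0) (flat_gt0E k.+1 t0).
  have dV : is_derive t 1 (fun s : R => s^-1) (- t ^- 2).
    apply: is_derive_eq; first by apply: is_deriveV; rewrite gt_eqF.
    by rewrite [_ *: _]mulr1.
  have dE := @is_derive1_comp R expR (fun s => - s^-1) t _ _
    (is_derive_expR _) (is_deriveN dV).
  have := is_deriveM (is_deriveX k dV) dE.
  set D := (X in is_derive _ _ _ X) => dM.
  have -> : t^-1 ^+ k.+2 * expR (- t^-1) - k%:R * (t^-1 ^+ k.+1 * expR (- t^-1)) = D.
    rewrite /D !fctE /= -!exprVn !exprS !/GRing.scale/=.
    case: k {dM D} => [|k]; rewrite ?expr0 /= ?exprS. ring. ring.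
  apply: (near_eq_is_derive _ dM).
  near=> s; rewrite flat_gt0E ?fctE//; near: s; exact: lt_nbhsr.
- rewrite (flat_le0 k.+2 (lexx 0)) (flat_le0 k.+1 (lexx 0)) mulr0 subr0.
  exact: is_derive0_quadratic (flat_quadratic k).
Unshelve. all: by end_near. Qed.

End flat_functions.

(** * A class of functions of one variable closed under differentiation, and composition with the
    logarithm *)

Section smooth_class.
Context {R : realType}.
Implicit Types (f g h : R -> R) (s t x : R).

(* expR (- t) is included because the derivative of f \o ln is again of this
   form, with f replaced by t |-> f' t * expR (- t). *)
Inductive flat_generated : (R -> R) -> Prop :=
| flat_generated_cst (c : R) : flat_generated (cst c)
| flat_generated_expRN : flat_generated (fun t => expR (- t))
| flat_generated_flat k (a b : R) : flat_generated (fun t => flat k (a * t + b))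
| flat_generatedD f g : flat_generated f -> flat_generated g ->
    flat_generated (f \+ g)
| flat_generatedM f g : flat_generated f -> flat_generated g ->
    flat_generated (f \* g).

Lemma is_derive_flat_affine k (a b t : R) :
  is_derive t (1 : R) (fun t => flat k (a * t + b))
    (a * flat k.+2 (a * t + b) + (- k%:R * a) * flat k.+1 (a * t + b)).
Proof.
have da : is_derive t (1 : R) (fun t => a * t + b) a.
  have := is_deriveD (is_deriveZ a (is_derive_id t (1 : R))) (is_derive_cst b t 1).
  by rewrite addr0 [_ *: _]mulr1.
have := @is_derive1_comp R (flat k) (fun t => a * t + b) t _ _ (is_derive_flat k _) da.
by set D := (_ * _ in X in X -> _); set D' := (X in _ -> is_derive _ _ _ X);
  suff -> : D = D' by []; rewrite /D /D'; ring.
Qed.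

Lemma flat_generated_derive f : flat_generated f ->
  exists2 f', flat_generated f' & forall t, is_derive t (1 : R) f (f' t).
Proof.
elim=> [c||k a b|{}f g _ [f' Ff' df] _ [g' Fg' dg]|{}f g Ff [f' Ff' df] Fg [g' Fg' dg]].
- exists (cst 0); first exact: flat_generated_cst.
  by move=> t; exact: is_derive_cst.
- exists (cst (-1) \* (fun t => expR (- t))).
    by apply: flat_generatedM; [exact: flat_generated_cst|exact: flat_generated_expRN].
  move=> t /=; rewrite mulrC.
  exact: (@is_derive1_comp R expR -%R t _ _ (is_derive_expR _) (is_deriveNid t 1)).
- exists ((cst a \* (fun t => flat k.+2 (a * t + b))) \+
     (cst (- k%:R * a) \* (fun t => flat k.+1 (a * t + b)))).
    by apply: flat_generatedD; apply: flat_generatedM;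
      [exact: flat_generated_cst|exact: flat_generated_flat|
       exact: flat_generated_cst|exact: flat_generated_flat].
  by move=> t; exact: is_derive_flat_affine.
- exists (f' \+ g'); first exact: flat_generatedD.
  by move=> t; apply: is_deriveD.
- exists ((f \* g') \+ (g \* f')); first by apply: flat_generatedD; exact: flat_generatedM.
  by move=> t; apply: is_deriveM.
Qed.

(** Vanishing below [d] passes to the derivative, so that [is_derive_comp_ln] can be applied again
    at every order. *)
Lemma is_derive_eq0_lt f f' (d t : R) :
  (forall t, is_derive t (1 : R) f (f' t)) ->
  (forall t, t < d -> f t = 0) -> t < d -> f' t = 0.
Proof.
move=> df f0 td.
have D0 : is_derive t (1 : R) f 0.
  apply: (near_eq_is_derive _ (is_derive_cst (0 : R) t (1 : R))).
  by near=> s; rewrite f0//; near: s; exact: lt_nbhsl.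
by rewrite -(@derive_val _ _ _ _ _ _ _ (df t)) (@derive_val _ _ _ _ _ _ _ D0).
Unshelve. all: by end_near. Qed.

(** For s > 0 this is the chain rule. For s <= 0 both sides are 0: [ln] is 0 on nonpositive reals,
    so f o ln vanishes on all of ]-oo, 1], a neighbourhood of s. *)
Lemma is_derive_comp_ln f f' (d s : R) : 0 < d ->
  (forall t, is_derive t (1 : R) f (f' t)) ->
  (forall t, t < d -> f t = 0) ->
  is_derive s (1 : R) (f \o @ln R) (f' (ln s) * expR (- ln s)).
Proof.
move=> d0 df f0; have [s0|s0] := ltP 0 s.
  have := is_derive1_comp (df (ln s)) (is_derive1_ln s0).
  by rewrite expRN lnK.
rewrite ln0// (is_derive_eq0_lt df f0 d0) mul0r.
apply: (near_eq_is_derive _ (is_derive_cst (0 : R) s (1 : R))).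
near=> x; rewrite /= f0//; apply: le_lt_trans d0; apply: ln_le0.
by near: x; apply: lt_le_nbhsl; apply: le_lt_trans s0 _.
Unshelve. all: by end_near. Qed.

End smooth_class.

(** * Smoothness of radial functions on R^n *)

Section smooth_rV.
Context {R : realType} {n : nat}.
Implicit Types (u : 'rV[R]_n -> R) (x v : 'rV[R]_n) (f : R -> R).

Definition sqnorm x : R := \sum_i x 0 i ^+ 2.

(** The two difference quotients are the same function of h. Directional derivatives thereby obey
    the chain rule of one variable, with no appeal to total differentiability. *)
Lemma is_derive_line u x v (l : R) :
  is_derive x v u l <-> is_derive (0 : R) (1 : R) (fun h => u (h *: v + x)) l.
Proof.
have E : (fun h : R => h^-1 *: (((fun h => u (h *: v + x)) \o shift 0) (h *: (1 : R))
      - u (0 *: v + x))) = (fun h : R => h^-1 *: ((u \o shift x) (h *: v) - u x)).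
  by apply/funext => h /=; rewrite addr0 [h *: 1]mulr1 scale0r add0r.
split=> -[]; rewrite /derivable /derive.
  by move=> H1 H2; apply: DeriveDef; rewrite /derivable /derive E.
by move=> H1 H2; apply: DeriveDef; rewrite /derivable /derive -E.
Qed.

Lemma is_derive_comp_line f u x v (a b : R) :
  is_derive (u x) (1 : R) f a -> is_derive x v u b ->
  is_derive x v (f \o u) (a * b).
Proof.
move=> df /is_derive_line du; apply/is_derive_line.
apply: (@is_derive1_comp R f (fun h => u (h *: v + x)) 0 a b _ du).
by rewrite scale0r add0r.
Qed.

Lemma is_derive_coord x v j : is_derive x v (fun y : 'rV[R]_n => y 0 j) (v 0 j).
Proof.
apply/is_derive_line.
have -> : (fun h : R => (h *: v + x) 0 j) = (fun h => v 0 j *: h + x 0 j).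
  by apply/funext => h; rewrite !mxE mulrC.
have := is_deriveD (is_deriveZ (v 0 j) (is_derive_id (0 : R) (1 : R)))
  (is_derive_cst (x 0 j) (0 : R) (1 : R)).
by rewrite addr0 [_ *: _]mulr1.
Qed.

Lemma is_derive_sqnorm x i :
  is_derive x (delta_mx 0 i : 'rV[R]_n) sqnorm (2 * x 0 i).
Proof.
have := @is_derive_sum _ _ _ n (fun j (y : 'rV[R]_n) => y 0 j ^+ 2) x (delta_mx 0 i) _
  (fun j => is_deriveX 2 (is_derive_coord x (delta_mx 0 i) j)).
rewrite [X in is_derive _ _ _ X -> _](bigD1 i)//= [X in _ + X]big1 => [|j ji]; last first.
  by rewrite mxE (negbTE ji) andbF scaler0.
rewrite addr0 mxE !eqxx expr1 [_ *: _]mulr1.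
by rewrite (_ : \sum_i _ = sqnorm)//; apply/funext => y; rewrite fct_sumE.
Qed.

Lemma continuous_sqnorm : continuous sqnorm.
Proof.
rewrite /sqnorm; elim: (index_enum _) => [|j r IH].
  by under eq_fun do rewrite big_nil; move=> x; exact: cst_continuous.
rewrite (_ : (fun x => _) = ((fun x : 'rV[R]_n => x 0 j) \* (fun x => x 0 j))
    \+ (fun x => \sum_(i <- r) x 0 i ^+ 2)).
  move=> x; apply: continuousD; last exact: IH.
  by apply: continuousM; exact: coord_continuous.
by apply/funext => x; rewrite big_cons expr2.
Qed.

(** The coordinates are included because differentiating a radial function produces the factor 2
    x_i. Vanishing below some d > 0 makes the radial generators identically 0 on the unit ball, away
    from the singularity of the logarithm. *)
Inductive rV_generated : ('rV[R]_n -> R) -> Prop :=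
| rV_generated_cst (c : R) : rV_generated (cst c)
| rV_generated_coord i : rV_generated (fun x => x 0 i)
| rV_generated_radial f (d : R) : flat_generated f -> 0 < d ->
    (forall t, t < d -> f t = 0) -> rV_generated (fun x => f (ln (sqnorm x)))
| rV_generatedD u w : rV_generated u -> rV_generated w -> rV_generated (u \+ w)
| rV_generatedM u w : rV_generated u -> rV_generated w -> rV_generated (u \* w).

Lemma rV_generated_derive u i : rV_generated u ->
  exists2 u', rV_generated u' &
    forall x, is_derive x (delta_mx 0 i : 'rV[R]_n) u (u' x).
Proof.
elim=> [c|j|f d Ff d0 f0|{}u v _ [u' Gu du] _ [v' Gv dv]
       |{}u v Fu [u' Gu du] Fv [v' Gv dv]].
- exists (cst 0); first exact: rV_generated_cst.
  by move=> x; exact: is_derive_cst.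
- exists (cst ((delta_mx 0 i : 'rV[R]_n) 0 j)); first exact: rV_generated_cst.
  by move=> x; exact: is_derive_coord.
- have [f' Ff' df] := flat_generated_derive Ff.
  (* The derivative is f'(ln |x|^2) |x|^-2 2 x_i, with |x|^-2 rewritten as exp(- ln |x|^2) to stay
     in the class. *)
  exists ((fun x => (f' \* (fun t => expR (- t))) (ln (sqnorm x)))
    \* (cst 2 \* (fun x => x 0 i))).
    apply: rV_generatedM.
      apply: (@rV_generated_radial _ d) => //.
        by apply: flat_generatedM => //; exact: flat_generated_expRN.
      by move=> t td /=; rewrite (is_derive_eq0_lt df f0 td) mul0r.
    by apply: rV_generatedM; [exact: rV_generated_cst|exact: rV_generated_coord].
  move=> x; apply: (@is_derive_comp_line (f \o @ln R) sqnorm).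
    exact: is_derive_comp_ln d0 df f0.
  exact: is_derive_sqnorm.
- exists (u' \+ v'); first exact: rV_generatedD.
  by move=> x; apply: is_deriveD.
- exists ((u \* v') \+ (v \* u')).
    by apply: rV_generatedD; exact: rV_generatedM.
  by move=> x; apply: is_deriveM.
Qed.

Lemma rV_generated_continuous u : rV_generated u -> continuous u.
Proof.
elim=> [c|j|f d Ff d0 f0|{}u v _ cu _ cv|{}u v _ cu _ cv] x.
- exact: cst_continuous.
- exact: coord_continuous.
- have [f' _ df] := flat_generated_derive Ff.
  apply: (@continuous_comp _ _ _ sqnorm (f \o @ln R)).
    exact: continuous_sqnorm.
  apply: differentiable_continuous; apply/derivable1_diffP.
  exact: (@ex_derive _ _ _ _ _ _ _ (is_derive_comp_ln _ d0 df f0)).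
- by apply: continuousD; [exact: cu|exact: cv].
- by apply: continuousM; [exact: cu|exact: cv].
Qed.

Lemma rV_generated_smooth u : rV_generated u -> smooth u.
Proof.
move=> Gu s /=; suff Gs : rV_generated (foldr (@partial R n) u s).
  split; first exact: rV_generated_continuous.
  move=> i x; have [u' _ du] := rV_generated_derive i Gs.
  exact: (@ex_derive _ _ _ _ _ _ _ (du x)).
elim: s => //= i s Gs; have [u' Gu' du] := rV_generated_derive i Gs.
rewrite (_ : partial i _ = u')//; apply/funext => x.
exact: (@derive_val _ _ _ _ _ _ _ (du x)).
Qed.

End smooth_rV.

(** * Integrals of combinations of indicators of cubes *)

Section box_integrals.
Context {R : realType} {n : nat}.
Implicit Types (x : 'rV[R]_n) (f g : 'rV[R]_n -> R).

(** Half-open sides make the diagonal cubes with sides [2^k, 2^(k+1)[ pairwise disjoint when n >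
    0. *)
Definition box (a b : R) : set 'rV[R]_n := [set x | forall i, `[a, b[%classic (x 0 i)].

Lemma measurable_box (a b : R) : measurable (box a b).
Proof.
rewrite (_ : box a b =
    \bigcap_(i in [set: 'I_n]) [set x : 'rV[R]_n | `[a, b[%classic (x 0 i)]).
  apply: fin_bigcap_measurable => // i _.
  rewrite -[X in measurable X]setTI.
  exact: (@measurable_fun_entry _ R 1 n 0 i measurableT _ (measurable_itv _)).
by apply/seteqP; split => x xA i; [move=> _; exact: xA|exact: xA].
Qed.

Lemma lebesgue_rV_cube (a b : R) : a <= b ->
  lebesgue_rV n (box a b) = ((b - a) ^+ n)%:E.
Proof.
move=> ab; rewrite /box (lebesgue_rV_box (A := fun _ => `[a, b[%classic))//.
rewrite [X in (_ = X)%E](_ : _ = \prod_(i < n) (b - a)%:E)%E; last first.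
  by rewrite prodEFin prodr_const card_ord.
apply: eq_bigr => i _; rewrite lebesgue_measure_itv/= lte_fin EFinB.
case: ltP => // ba; have -> : b = a by apply/eqP; rewrite eq_le ba.
by rewrite -EFinB subrr.
Qed.

(** Linearity alone, so the cubes may overlap: they are nested in [integral_weight_le] and disjoint
    in [integral_weight_ge]. *)
Lemma integral_sum_box (m : nat) (c a b : 'I_m -> R) :
  (forall k, 0 <= c k) -> (forall k, a k <= b k) ->
  (\int[lebesgue_rV n]_x (\sum_k c k * \1_(box (a k) (b k)) x)%:E)%E =
  (\sum_k c k * (b k - a k) ^+ n)%:E.
Proof.
move=> c0 ab.
under eq_integral do rewrite -sumEFin.
rewrite ge0_integral_sum//; last 2 first.
- move=> k; apply/measurable_EFinP; apply: measurable_funM => //.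
  by apply: measurable_indic; exact: measurable_box.
- by move=> k x _; rewrite lee_fin mulr_ge0.
rewrite -sumEFin; apply: eq_bigr => k _.
under eq_integral do rewrite EFinM.
rewrite ge0_integralZl//; last 2 first.
- by apply/measurable_EFinP; apply: measurable_indic; exact: measurable_box.
- by rewrite lee_fin.
rewrite integral_indic//=; last exact: measurable_box.
by rewrite setIT EFinM lebesgue_rV_cube.
Qed.

(* No measurability is needed: the integral of a nonnegative function is a
   supremum over the simple functions below it. *)
Lemma ge0_le_integralT f g : (forall x, 0 <= f x) -> (forall x, f x <= g x) ->
  (\int[lebesgue_rV n]_x (f x)%:E <= \int[lebesgue_rV n]_x (g x)%:E)%E.
Proof.
move=> f0 fg; rewrite !ge0_integralTE.
- apply: ereal_sup_le => _ [h /= hf <-]; exists h => //= x.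
  by apply: le_trans (hf x) _; rewrite lee_fin.
- by move=> x; rewrite lee_fin (le_trans (f0 x)).
- by move=> x; rewrite lee_fin.
Qed.

End box_integrals.

(** * Dyadic bounds for integrals with the weight |x|^-n *)

Section shells.
Context {R : realType} {n : nat}.
Implicit Types (x : 'rV[R]_n) (f : 'rV[R]_n -> R).

Lemma enorm_ge0 x : 0 <= enorm x.
Proof. exact: sqrtr_ge0. Qed.

Lemma ler_coord_enorm x i : `|x 0 i| <= enorm x.
Proof.
rewrite -sqrtr_sqr ler_sqrt ?sumr_ge0// => [|j _]; last exact: sqr_ge0.
by rewrite (bigD1 i)//= lerDl sumr_ge0// => j _; exact: sqr_ge0.
Qed.

Lemma enorm_le x (b : R) : (0 < n)%N -> (forall i, `|x 0 i| <= b) -> enorm x <= n%:R * b.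
Proof.
move=> n_gt0 xb; have b0 : 0 <= b by apply: le_trans (xb (Ordinal n_gt0)).
rewrite -[leRHS]ger0_norm ?mulr_ge0// -sqrtr_sqr ler_sqrt ?sqr_ge0//.
have : \sum_i x 0 i ^+ 2 <= \sum_(i < n) b ^+ 2.
  apply: ler_sum => i _; rewrite -real_normK ?num_real//.
  by rewrite ler_pXn2r ?nnegrE.
move=> /le_trans; apply; rewrite sumr_const card_ord exprMn -[leLHS]mulr_natl.
rewrite ler_wpM2r ?sqr_ge0// expr2 -natrM ler_nat.
by rewrite leq_pmull.
Qed.

Lemma powR_anti_natN (x y : R) : 0 < x -> x <= y -> y `^ (- n%:R) <= x `^ (- n%:R).
Proof.
move=> x0 xy; have y0 := lt_le_trans x0 xy.
rewrite !powRN !powR_mulrn ?(ltW x0) ?(ltW y0)//.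
rewrite lef_pV2 ?posrE ?exprn_gt0//.
by rewrite lerXn2r ?nnegrE ?(ltW x0) ?(ltW y0).
Qed.

Lemma exists_dyadic (t : R) (m : nat) : 1 <= t -> t < 2 ^+ m ->
  exists2 k, (k < m)%N & 2 ^+ k <= t < 2 ^+ k.+1.
Proof.
move=> t1; elim: m => [|m IH] tm; first by move: tm; rewrite expr0 ltNge t1.
have [tm'|tm'] := ltP t (2 ^+ m).
  by have [k km kt] := IH tm'; exists k => //; exact: ltn_trans km _.
by exists m => //; rewrite tm'.
Qed.

(** On the shell 2^k <= |x| < 2^(k+1) the weight is at most 2^(-kn), and the shell lies in a cube of
    side 4 2^k. Each of the m shells thus contributes at most M 4^n, whatever k. *)
Lemma integral_weight_le f (M : R) (m : nat) :
  (forall x, 0 <= f x <= M) ->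
  (forall x, f x != 0 -> 1 <= enorm x < 2 ^+ m) ->
  (\int[lebesgue_rV n]_x (enorm x `^ (- n%:R) * f x)%:E
    <= (m%:R * (M * 4 ^+ n))%:E)%E.
Proof.
move=> f0M f1.
have M0 : 0 <= M by have /andP[f0 fM] := f0M 0; exact: le_trans fM.
have w0 x : 0 <= enorm x `^ (- n%:R) * f x.
  by rewrite mulr_ge0 ?powR_ge0//; case/andP: (f0M x).
pose c (k : 'I_m) : R := M * (2 ^+ k) ^- n.
have c0 k : 0 <= c k by rewrite mulr_ge0// invr_ge0 !exprn_ge0.
pose b (k : 'I_m) : R := 2 ^+ k.+1.
have b0 k : 0 < b k by rewrite exprn_gt0.
apply: (le_trans (ge0_le_integralT
   (g := fun x => \sum_k c k * \1_(box (- b k) (b k)) x) w0 _)).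
  move=> x; have [fx0|fx] := eqVneq (f x) 0.
    by rewrite fx0 mulr0 sumr_ge0// => k _; rewrite mulr_ge0.
  have /andP[x1 xm] := f1 x fx.
  have [k km /andP[kx xk]] := exists_dyadic x1 xm.
  rewrite (bigD1 (Ordinal km))//= indicE mem_set; last first.
    move=> i /=; rewrite in_itv/=.
    have := le_lt_trans (ler_coord_enorm x i) xk.
    by rewrite ltr_norml => /andP[/ltW -> ->].
  rewrite mulr1 ler_wpDr//; first by rewrite sumr_ge0// => j _; rewrite mulr_ge0.
  rewrite mulrC ler_pM ?powR_ge0//; do ?by case/andP: (f0M x).
  have := powR_anti_natN (exprn_gt0 k (ltr0n R 2)) kx.
  by rewrite (powRN (2 ^+ k)) powR_mulrn// exprn_ge0.
rewrite integral_sum_box//; last by move=> k; rewrite ge0_cp// ltW.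
rewrite lee_fin (eq_bigr (fun _ => M * 4 ^+ n)).
  by rewrite sumr_const card_ord mulr_natl.
move=> k _; rewrite /c /b opprK -mulrA -exprVn -exprMn exprS.
congr (_ * _ ^+ _); rewrite -mulrDl mulrCA mulVf ?expf_neq0//; ring.
Qed.

(** The l disjoint cubes with sides [2^(m+k), 2^(m+k+1)[ are used. There 2^(m+k) <= |x| <= n
    2^(m+k+1) <= 2^(n+1+m+k), so weight times volume is at least 2^(-(n+1)n). The extra n in the
    upper radius pays for n <= 2^n. *)
Lemma integral_weight_ge f (c : R) (m l : nat) : (0 < n)%N -> 0 <= c ->
  (forall x, 0 <= f x) ->
  (forall x, 2 ^+ m <= enorm x <= 2 ^+ (m + n + l) -> c <= f x) ->
  ((l%:R * (c * 2 ^- (n.+1 * n)))%:E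
    <= \int[lebesgue_rV n]_x (enorm x `^ (- n%:R) * f x)%:E)%E.
Proof.
move=> n_gt0 c0 f0 fc.
pose a (k : 'I_l) : R := 2 ^+ (m + k).
have a0 k : 0 < a k by rewrite exprn_gt0.
pose d (k : 'I_l) : R := c * (2 ^+ (n.+1 + (m + k))) ^- n.
have d0 k : 0 <= d k by rewrite mulr_ge0// invr_ge0 !exprn_ge0.
have -> : (l%:R * (c * 2 ^- (n.+1 * n)))%:E =
    (\int[lebesgue_rV n]_x (\sum_k d k * \1_(box (a k) (2 * a k)) x)%:E)%E.
  rewrite integral_sum_box//; last by move=> k; rewrite ler_peMl ?ler1n// ltW.
  rewrite (eq_bigr (fun _ => c * 2 ^- (n.+1 * n))).
    by rewrite sumr_const card_ord mulr_natl.
  move=> k _; rewrite /d /a; set y := 2 ^+ (m + k).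
  rewrite exprD -/y exprMn invfM -mulrA -exprM.
  congr (_ * _); rewrite (_ : 2 * y - y = y); last by ring.
  by rewrite -mulrA mulVf ?mulr1// !expf_neq0.
apply: ge0_le_integralT => x; first by rewrite sumr_ge0// => k _; rewrite mulr_ge0.
have [[k xk]|nx] := pselect (exists k, box (a k) (2 * a k) x); last first.
  rewrite big1 ?mulr_ge0 ?powR_ge0// => k _.
  by rewrite indicE memNset ?mulr0// => xk; apply: nx; exists k.
have x0 i : a k <= x 0 i < 2 * a k by have := xk i; rewrite /= in_itv.
(* Disjointness: a coordinate lying in both dyadic intervals gives k < j + 1 and j < k + 1. *)
rewrite (bigD1 k)//= big1 => [|j jk]; last first.
  rewrite indicE memNset ?mulr0// => xj.
  have := xj (Ordinal n_gt0); have := x0 (Ordinal n_gt0); rewrite /= in_itv/= /a.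
  move=> /andP[h1 h2] /andP[h3 h4].
  have : (m + k < (m + j).+1)%N.
    by rewrite -(@ltr_eXn2l R 2) ?ltr1n// exprS; apply: le_lt_trans h1 h4.
  have : (m + j < (m + k).+1)%N.
    by rewrite -(@ltr_eXn2l R 2) ?ltr1n// exprS; apply: le_lt_trans h3 h2.
  rewrite !ltnS !leq_add2l => jk' kj'; case/negP: jk; apply/eqP/val_inj/eqP.
  by rewrite eqn_leq jk' kj'.
rewrite addr0 indicE mem_set// mulr1 mulrC.
have ax : a k <= enorm x.
  have /andP[h _] := x0 (Ordinal n_gt0).
  by apply: le_trans h _; apply: le_trans (ler_norm _) (ler_coord_enorm _ _).
have xa : enorm x <= 2 ^+ (n.+1 + (m + k)).
  apply: (le_trans (@enorm_le x (2 * a k) n_gt0 _)).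
    move=> i; have /andP[h1 h2] := x0 i; rewrite ger0_norm ltW//.
    exact: lt_le_trans h1.
  rewrite addSnnS exprD [in leRHS]exprS -/(a k) ler_wpM2r ?mulr_ge0 ?ltW//.
  by rewrite -natrX ltr_nat ltn_expl.
have wx : 2 ^+ (n.+1 + (m + k)) ^- n <= enorm x `^ (- n%:R).
  have := powR_anti_natN (lt_le_trans (a0 k) ax) xa.
  by rewrite (powRN (2 ^+ _)) powR_mulrn// exprn_ge0.
rewrite ler_pM ?invr_ge0 ?exprn_ge0//; apply: fc; apply/andP; split.
  by apply: le_trans ax; rewrite ler_eXn2l ?ltr1n// leq_addr.
apply: le_trans xa _; rewrite ler_eXn2l ?ltr1n//.
by rewrite addSn addnA [(n + m)%N]addnC -addnS leq_add2l ltn_ord.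
Qed.

End shells.

(** * The logarithmic test function, its gradient and its support *)

Section test_function.
Context {R : realType}.
Implicit Types (L t : R).

(** The threshold 3 bounds both t/L - 1 and 4 - t/L when L < t < 4L. *)
Lemma flat_le k t : t <= 3 -> flat k t <= (k.+2)`!%:R * 9.
Proof.
move=> t3; have [t0|t0] := leP t 0; first by rewrite flat_le0// mulr_ge0.
apply: le_trans (ler_norm _) _; apply: le_trans (flat_quadratic _ _) _.
rewrite ler_wpM2l// (_ : 9 = 3 ^+ 2 :> R); last by rewrite -natrX.
by rewrite ler_pXn2r// nnegrE ltW.
Qed.

(** With s = t/L this is exp(-1/(s-1)) exp(-1/(4-s)) for 1 < s < 4 and 0 elsewhere, in the affine
    form of [flat_generated_flat]. *)
Definition bump L t : R := flat 0 (L^-1 * t - 1) * flat 0 (- L^-1 * t + 4).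

(** The derivative of [bump L]; only [flat 2] appears because the term with factor k vanishes at k =
    0. *)
Definition dbump L t : R := L^-1 *
  (flat 2 (L^-1 * t - 1) * flat 0 (- L^-1 * t + 4)
   - flat 0 (L^-1 * t - 1) * flat 2 (- L^-1 * t + 4)).

Lemma bump_ge0 L t : 0 <= bump L t.
Proof. by rewrite mulr_ge0 ?flat_ge0. Qed.

Lemma bump_generated L : flat_generated (bump L).
Proof. by apply: flat_generatedM; exact: flat_generated_flat. Qed.

Lemma is_derive_bump L t : is_derive t (1 : R) (bump L) (dbump L t).
Proof.
have := is_deriveM (is_derive_flat_affine 0 L^-1 (- 1) t)
  (is_derive_flat_affine 0 (- L^-1) 4 t).
set D := (X in is_derive _ _ _ X -> _) => dM.
suff -> : dbump L t = D by exact: dM.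
by rewrite /D /dbump /GRing.scale/=; ring.
Qed.

(** The first factor vanishes for t <= L and the second for t >= 4L. General k and l cover [bump]
    and both terms of [dbump]. *)
Lemma flat_affine_supp k l L t : 0 < L ->
  L < t < 4 * L \/ flat k (L^-1 * t - 1) * flat l (- L^-1 * t + 4) = 0.
Proof.
move=> L0; have [tL|Lt] := leP t L.
  by right; rewrite flat_le0 ?mul0r// subr_le0 ler_pdivrMl// mulr1.
have [Lt4|t4] := leP (4 * L) t.
  right; rewrite mulrC flat_le0 ?mul0r// mulNr addrC subr_le0.
  by rewrite ler_pdivlMl// mulrC.
by left; apply/andP.
Qed.

Lemma flat_affine_le k l L t : 0 < L ->
  `|flat k (L^-1 * t - 1) * flat l (- L^-1 * t + 4)|
  <= (k.+2)`!%:R * 9 * ((l.+2)`!%:R * 9).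
Proof.
move=> L0; have [/andP[Lt tL]|->] := flat_affine_supp k l t L0; last first.
  by rewrite normr0 !mulr_ge0.
rewrite ger0_norm ?mulr_ge0 ?flat_ge0// ler_pM ?flat_ge0// flat_le//.
  by rewrite lerBlDr ler_pdivrMl// mulrC (_ : 3 + 1 = 4 :> R) ?ltW//; ring.
rewrite mulNr; suff : 1 <= L^-1 * t by lra.
by rewrite ler_pdivlMl// mulr1 ltW.
Qed.

Lemma bump_neq0 L t : 0 < L -> bump L t != 0 -> L < t < 4 * L.
Proof. by move=> L0; have [//|bE] := flat_affine_supp 0 0 t L0; rewrite /bump bE eqxx. Qed.

Lemma dbump_neq0 L t : 0 < L -> dbump L t != 0 -> L < t < 4 * L.
Proof.
move=> L0; rewrite /dbump; have [//|->] := flat_affine_supp 2 0 t L0.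
by have [//|->] := flat_affine_supp 0 2 t L0; rewrite subrr mulr0 eqxx.
Qed.

Lemma bump_bounded : exists2 C : R, 0 < C &
  forall L t, 0 < L -> bump L t <= C.
Proof.
exists ((0.+2)`!%:R * 9 * ((0.+2)`!%:R * 9)); first by rewrite !mulr_gt0// ltr0n.
move=> L t L0; apply: le_trans (ler_norm _) _.
exact: flat_affine_le.
Qed.

(** The gain 1/L comes from the dilation and is what makes the gradient integral scale like
    K^(1-p). *)
Lemma dbump_bounded : exists2 C : R, 0 < C &
  forall L t, 0 < L -> `|dbump L t| <= C / L.
Proof.
pose c k l : R := (k.+2)`!%:R * 9 * ((l.+2)`!%:R * 9).
have c0 k l : 0 < c k l by rewrite !mulr_gt0// ltr0n fact_gt0.
exists (c 2%N 0%N + c 0%N 2%N); first exact: addr_gt0.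
move=> L t L0; rewrite /dbump normrM gtr0_norm ?invr_gt0// mulrC.
rewrite ler_wpM2r ?invr_ge0 ?(ltW L0)//.
by apply: le_trans (ler_normB _ _) (lerD _ _); exact: flat_affine_le.
Qed.

(** In the middle third both flat factors have argument at least 1, where exp(-1/s) >= exp(-1). *)
Lemma bump_ge L t : 0 < L -> 2 * L <= t <= 3 * L -> expR (- 1) ^+ 2 <= bump L t.
Proof.
move=> L0 /andP[Lt tL].
have flat1 s : 1 <= s -> expR (- 1) <= flat 0 s.
  move=> s1; have s0 : 0 < s by lra.
  by rewrite flat_gt0E// expr0 mul1r ler_expR lerN2 invf_le1.
rewrite expr2 ler_pM ?expR_ge0//; apply: flat1.
  by rewrite lerBrDr ler_pdivlMl// mulrC; lra.
rewrite mulNr; suff : L^-1 * t <= 3 by lra.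
by rewrite ler_pdivrMl// mulrC.
Qed.

Context {n : nat}.
Implicit Types x : 'rV[R]_n.

(** Using |x|^2 in place of |x| keeps the inner function polynomial; the resulting factor 2 in the
    logarithm is absorbed by the choice of L. *)
Definition log_bump L x : R := bump L (ln (sqnorm x)).

Lemma sqnormE x : sqnorm x = enorm x ^+ 2.
Proof. by rewrite sqr_sqrtr// sumr_ge0// => i _; exact: sqr_ge0. Qed.

Lemma ln_sqnorm x : ln (sqnorm x) = 2 * ln (enorm x).
Proof.
rewrite sqnormE; have [->|x0] := eqVneq (enorm x) 0.
  by rewrite expr0n/= !ln0// mulr0.
by rewrite lnXn ?mulr_natl// lt_neqAle eq_sym x0 enorm_ge0.
Qed.

Lemma log_bump_smooth L : 0 < L -> smooth (log_bump L).
Proof.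
move=> L0; apply: rV_generated_smooth.
apply: (rV_generated_radial (bump_generated L) L0) => t tL.
apply: contraTeq tL => /(bump_neq0 L0)/andP[/ltW]; rewrite -leNgt//.
Qed.

Lemma gradient_log_bump L x : 0 < L -> gradient (log_bump L) x =
  (2 * (dbump L (ln (sqnorm x)) * expR (- ln (sqnorm x)))) *: x.
Proof.
move=> L0; apply/rowP => i; rewrite !mxE.
have := @is_derive_comp_line R n (bump L \o @ln R) sqnorm x (delta_mx 0 i) _ _
  (is_derive_comp_ln _ L0 (is_derive_bump L) _) (is_derive_sqnorm x i).
have b0 t : t < L -> bump L t = 0.
  move=> tL; apply: contraTeq tL => /(bump_neq0 L0)/andP[/ltW]; rewrite -leNgt//.
move=> /(_ b0) d.
rewrite /partial (@derive_val _ _ _ _ _ _ _ d); ring.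
Qed.

Lemma enormZ (c : R) x : enorm (c *: x) = `|c| * enorm x.
Proof.
rewrite /enorm -sqrtr_sqr -sqrtrM ?sqr_ge0// mulr_sumr.
by congr Num.sqrt; apply: eq_bigr => i _; rewrite mxE exprMn.
Qed.

(* At x = 0 both sides vanish, whatever the junk values of the weights, because
   ln 0 = 0 and dbump L 0 = 0. *)
Lemma gradient_integrand L (p : R) x : 0 < L -> 0 < p ->
  enorm x `^ (p - n%:R) * enorm (gradient (log_bump L) x) `^ p =
  enorm x `^ (- n%:R) * (2 * `|dbump L (ln (sqnorm x))|) `^ p.
Proof.
move=> L0 p0; rewrite gradient_log_bump// enormZ.
set D := dbump _ _; have [->|D0] := eqVneq D 0.
  by rewrite mul0r !mulr0 normr0 mul0r mulr0 powR0 ?gt_eqF// !mulr0.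
have /andP[Ls _] := dbump_neq0 L0 D0.
have x0 : 0 < enorm x.
  rewrite lt_neqAle enorm_ge0 andbT eq_sym; apply: contraTneq Ls => x0.
  by rewrite ln_sqnorm x0 ln0// mulr0 -leNgt ltW.
(* This says 2 |D| = |grad u| |x|; the factor |x|^p is then moved into the weight. *)
have -> : 2 * `|D| = `|2 * (D * expR (- ln (sqnorm x)))| * enorm x * enorm x.
  rewrite !normrM (gtr0_norm (expR_gt0 _)) expRN lnK ?posrE ?sqnormE ?exprn_gt0//.
  rewrite (ger0_norm (ler0n _ 2)); by field; rewrite gt_eqF.
set g := _ * enorm x; have g0 : 0 <= g by rewrite mulr_ge0 ?enorm_ge0.
rewrite (powRM _ g0 (enorm_ge0 x)) powRD ?(gt_eqF x0) ?implybT//; ring.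
Qed.

Variable K : nat.
Hypothesis K_gt0 : (0 < K)%N.
(** Chosen so that L < ln |x|^2 < 4L means 2^K < |x| < 2^(4K). *)
Let L : R := 2 * (K%:R * ln 2).

Let ln2_gt0 : 0 < ln 2 :> R.
Proof. by rewrite ln_gt0// ltr1n. Qed.

Let L_gt0 : 0 < L.
Proof. by rewrite !mulr_gt0// ltr0n. Qed.

Let ln_exp2 (m : nat) : ln (2 ^+ m) = m%:R * ln 2 :> R.
Proof. by rewrite lnXn// mulr_natl. Qed.

Lemma dyadic_support x : L < ln (sqnorm x) < 4 * L -> 1 <= enorm x < 2 ^+ (4 * K).
Proof.
rewrite ln_sqnorm /L (mulrCA 4 2) !ltr_pM2l// => /andP[Kx xK].
have x1 : 1 < enorm x.
  rewrite ltNge; apply/negP => /ln_le0; apply/negP; rewrite -ltNge.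
  by apply: lt_trans Kx; rewrite mulr_gt0 ?ltr0n.
rewrite ltW//= -ltr_ln ?posrE ?exprn_gt0//; last by rewrite (lt_trans _ x1).
by rewrite ln_exp2 natrM -mulrA.
Qed.

Lemma dyadic_plateau x : 2 ^+ (2 * K) <= enorm x <= 2 ^+ (3 * K) ->
  2 * L <= ln (sqnorm x) <= 3 * L.
Proof.
rewrite ln_sqnorm /L (mulrCA 3 2) !ler_pM2l// => /andP[Kx xK].
have x0 : 0 < enorm x by apply: lt_le_trans Kx; rewrite exprn_gt0.
rewrite !mulrA -!natrM -!ln_exp2 !ler_ln ?posrE ?exprn_gt0//.
by rewrite Kx xK.
Qed.

Lemma log_bump_Cc : Cc_infty [set~ 0] (log_bump L : 'rV[R]_n -> R).
Proof.
(* The closed annulus 1 <= |x| <= 2^(4K): closed by continuity of |x|^2, contained in a compact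
   cube, and avoiding 0. *)
pose S := [set x : 'rV[R]_n | `[1, (2 ^+ (4 * K)) ^+ 2]%classic (sqnorm x)].
have Sx x : log_bump L x != 0 -> 1 <= enorm x < 2 ^+ (4 * K).
  by move=> /(bump_neq0 L_gt0); exact: dyadic_support.
have clS : closed S.
  by apply: closed_comp => [x _|]; [exact: continuous_sqnorm|exact: itv_closed].
have suppS : tsupport (log_bump L : 'rV[R]_n -> R) `<=` S.
  rewrite /tsupport [X in _ `<=` X]((closure_id S).1 clS); apply: closureS.
  move=> y /= /Sx/andP[y1 y2]; rewrite /S/= in_itv/= sqnormE exprn_ege1//=.
  by rewrite lerXn2r ?nnegrE ?enorm_ge0 ?exprn_ge0// ltW.
split; first exact: log_bump_smooth.
  have cB := @rV_compact R n (fun=> `[- 2 ^+ (4 * K), 2 ^+ (4 * K)]%classic)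
    (fun=> segment_compact (a := - 2 ^+ (4 * K)) (b := 2 ^+ (4 * K))).
  apply: (subclosed_compact _ cB); first exact: closed_closure.
  apply: subset_trans suppS _ => x; rewrite /S/= in_itv/= => /andP[_ xK] i.
  rewrite /= in_itv/= -ler_norml; apply: le_trans (ler_coord_enorm _ _) _.
  move: xK; rewrite sqnormE; rewrite ler_pXn2r ?nnegrE ?enorm_ge0 ?exprn_ge0//.
move=> x /suppS; rewrite /S/= in_itv/= => /andP[x1 _] x0; move: x1.
by rewrite x0 /sqnorm big1 ?ler10// => i _; rewrite mxE expr0n.
Qed.

End test_function.

(** * Growth in K of the three integrals of the quotient *)

Section quotient.
Context {R : realType}.

(** The upper bounds make all three integrals finite, x4 doing so for the denominator; what remains
    is monotonicity of real powers. *)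
Lemma poweR_quotient_le (I1 I2 I3 : \bar R) (x1 x2 x3 x4 al be ga : R) :
  0 <= al -> 0 <= be -> 0 <= ga -> 0 < x3 ->
  (0 <= I1 <= x1%:E)%E -> (0 <= I2 <= x2%:E)%E -> (x3%:E <= I3 <= x4%:E)%E ->
  (I1 `^ al * I2 `^ be / I3 `^ ga <= (x1 `^ al * x2 `^ be / x3 `^ ga)%:E)%E.
Proof.
move=> al0 be0 ga0 x30.
case: I1 => [y1||] // /andP[y10 y1x]; last by rewrite leye_eq in y1x.
case: I2 => [y2||] // /andP[y20 y2x]; last by rewrite leye_eq in y2x.
case: I3 => [y3||] // /andP[y30 y3x]; last by rewrite leye_eq in y3x.
rewrite !lee_fin in y10 y20 y30 y1x y2x.
have y3p : 0 < y3 by exact: lt_le_trans y30.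
rewrite !poweR_EFin inver gt_eqF ?powR_gt0// -!EFinM lee_fin.
rewrite ler_pM ?mulr_ge0 ?powR_ge0 ?invr_ge0 ?powR_ge0//.
  by rewrite ler_pM ?powR_ge0// ge0_ler_powR// nnegrE// (le_trans _ y1x, le_trans _ y2x).
rewrite lef_pV2 ?posrE ?powR_gt0//.
by rewrite ge0_ler_powR// nnegrE ltW.
Qed.

Lemma exists_nat_powR_le (m : nat) (C e E : R) : 0 < C -> 0 < e -> E < 0 ->
  exists2 K : nat, (m <= K)%N && (0 < K)%N & C * K%:R `^ E <= e.
Proof.
(* This t solves C t^E = e, and since E < 0 any K >= t will do. *)
move=> C0 e0 E0; pose t := (C / e) `^ (- E)^-1.
exists (maxn m (Num.truncn t).+1).
  by rewrite leq_maxl (leq_trans _ (leq_maxr _ _)).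
set K := maxn _ _; have tK : t <= K%:R.
  by apply: le_trans (ltW (truncnS_gt t)) _; rewrite ler_nat leq_maxr.
have nE : 0 < - E by rewrite oppr_gt0.
have : t `^ (- E) <= K%:R `^ (- E).
  by rewrite ge0_ler_powR ?nnegrE ?powR_ge0// ltW.
rewrite /t -powRrM mulVf ?gt_eqF// powRr1 ?divr_ge0 ?(ltW C0) ?(ltW e0)// ler_pdivrMr//.
have K0 : 0 < K%:R `^ E.
  by rewrite powR_gt0// (lt_le_trans _ tK)// powR_gt0// divr_gt0.
rewrite powRN => h.
by move: h; rewrite ler_pdivlMl// mulrC.
Qed.

Context {n : nat}.
Hypothesis n_gt0 : (0 < n)%N.
Local Notation L K := (2 * (K%:R * ln 2)).

Let ln2_gt0 : 0 < ln 2 :> R.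
Proof. by rewrite ln_gt0// ltr1n. Qed.

Let L_gt0 (K : nat) : (0 < K)%N -> 0 < L K :> R.
Proof. by move=> K0; rewrite !mulr_gt0// ltr0n. Qed.

Lemma integral_gradient_le (p : R) : 0 < p ->
  exists2 A : R, 0 < A & forall K : nat, (0 < K)%N ->
  (\int[lebesgue_rV n]_x (enorm x `^ (p - n%:R) *
     enorm (gradient (log_bump (L K)) x) `^ p)%:E <= (A * K%:R `^ (1 - p))%:E)%E.
Proof.
move=> p0; have [C C0 HC] := @dbump_bounded R.
(* There are 4K shells, each contributing at most (2C/L)^p 4^n, and 2C/L = (C / ln 2) / K. *)
exists (4 * (C / ln 2) `^ p * 4 ^+ n).
  by rewrite !mulr_gt0// powR_gt0// divr_gt0.
move=> K K0; have L0 := L_gt0 K0.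
under eq_integral do rewrite gradient_integrand//.
have b0 : 0 <= 2 * (C / L K) :> R by rewrite !mulr_ge0 ?invr_ge0// ltW.
apply: (le_trans (@integral_weight_le R n _ ((2 * (C / L K)) `^ p) (4 * K) _ _)).
- move=> x; rewrite powR_ge0 /=.
  have xC : 2 * `|dbump (L K) (ln (sqnorm x))| <= 2 * (C / L K).
    by rewrite ler_wpM2l// HC.
  apply: ge0_ler_powR => //; [exact: ltW|rewrite nnegrE..].
  by rewrite mulr_ge0.
- move=> x fx; apply: (dyadic_support K0); apply: dbump_neq0 => //.
  apply: contraNneq fx => ->; rewrite normr0 mulr0 powR0//.
  by rewrite gt_eqF.
have KR : 0 < K%:R :> R by rewrite ltr0n.
rewrite lee_fin (_ : 2 * (C / L K) = C / ln 2 * K%:R `^ (- 1)); last first.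
  by rewrite powR_inv1 ?ltW//; field; rewrite !gt_eqF.
rewrite powRM ?powR_ge0 ?divr_ge0 ?(ltW ln2_gt0) ?(ltW C0)// -powRrM mulN1r.
rewrite powRD ?(gt_eqF KR) ?implybT// powRr1 ?(ltW KR)// natrM.
by rewrite le_eqVlt; apply/orP; left; apply/eqP; ring.
Qed.

Lemma integral_log_bump_le (s : R) : 0 < s ->
  exists2 A : R, 0 < A & forall K : nat, (0 < K)%N ->
  (\int[lebesgue_rV n]_x (enorm x `^ (- n%:R) * `|log_bump (L K) x| `^ s)%:E
   <= (A * K%:R)%:E)%E.
Proof.
move=> s0; have [C C0 HC] := @bump_bounded R.
exists (4 * C `^ s * 4 ^+ n); first by rewrite !mulr_gt0// powR_gt0.
move=> K K0; have L0 := L_gt0 K0.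
apply: (le_trans (@integral_weight_le R n _ (C `^ s) (4 * K) _ _)).
- move=> x; rewrite powR_ge0/= ge0_ler_powR ?nnegrE ?(ltW C0) ?(ltW s0)//.
  by rewrite ger0_norm ?bump_ge0// HC.
- move=> x fx; apply: (dyadic_support K0); apply: bump_neq0 => //.
  by apply: contraNneq fx => fx; rewrite /log_bump fx normr0 powR0// gt_eqF.
by rewrite lee_fin natrM le_eqVlt; apply/orP; left; apply/eqP; ring.
Qed.

(** The plateau 2^(2K) <= |x| <= 2^(3K) has K dyadic scales. Fitting cubes inside it costs n of
    them, and K - n >= K/2 once K >= 2n. *)
Lemma integral_log_bump_ge (s : R) : 0 < s ->
  exists2 B : R, 0 < B & forall K : nat, (2 * n <= K)%N -> (0 < K)%N ->
  ((B * K%:R)%:E <=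
   \int[lebesgue_rV n]_x (enorm x `^ (- n%:R) * `|log_bump (L K) x| `^ s)%:E)%E.
Proof.
move=> s0; pose c : R := (expR (- 1) ^+ 2) `^ s.
have c0 : 0 < c by rewrite powR_gt0// exprn_gt0// expR_gt0.
exists (2^-1 * (c * 2 ^- (n.+1 * n))).
  by rewrite !mulr_gt0// invr_gt0// exprn_gt0.
move=> K nK K0; have L0 := L_gt0 K0.
have := @integral_weight_ge R n (fun x => `|log_bump (L K) x| `^ s) c (2 * K) (K - n)
  n_gt0 (ltW c0).
set I := (\int[_]_x _)%E => H; apply: (@le_trans _ _ _ _ _ _ (H _ _)).
- rewrite lee_fin mulrAC ler_wpM2r// ?mulr_ge0 ?invr_ge0 ?exprn_ge0 ?(ltW c0)//.
  rewrite ler_pdivrMl// -natrM ler_nat; lia.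
- by move=> x; rewrite powR_ge0.
- move=> x xK; rewrite ge0_ler_powR ?nnegrE ?exprn_ge0 ?expR_ge0// ?(ltW s0)//.
  rewrite ger0_norm ?bump_ge0//; apply: bump_ge => //; apply: dyadic_plateau.
  move: xK; congr (is_true (_ <= _ <= 2 ^+ _)); lia.
Qed.

End quotient.

(** * Nonvanishing of the test functions and the value of the infimum *)

Lemma log_bump_neq0 (R : realType) (n K : nat) : (0 < n)%N -> (0 < K)%N ->
  exists x : 'rV[R]_n, log_bump (2 * (K%:R * ln 2)) x != 0.
Proof.
move=> n0 K0; pose e : 'rV[R]_n := delta_mx 0 (Ordinal n0).
have e1 : enorm e = 1.
  rewrite /enorm (bigD1 (Ordinal n0))//= big1 => [|j j0].
    by rewrite mxE !eqxx expr1n addr0 sqrtr1.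
  by rewrite mxE (negbTE j0) andbF expr0n.
(* A point on the inner boundary of the plateau. *)
exists (2 ^+ (2 * K) *: e); rewrite gt_eqF//.
have L0 : 0 < 2 * (K%:R * ln 2) :> R by rewrite !mulr_gt0 ?ltr0n// ln_gt0 ?ltr1n.
apply: lt_le_trans (bump_ge L0 (dyadic_plateau _)).
  by rewrite exprn_gt0// expR_gt0.
rewrite enormZ e1 mulr1 ger0_norm ?exprn_ge0// lexx/=.
by rewrite ler_eXn2l ?ltr1n// leq_mul2r orbT.
Qed.

Theorem proposition1 (R : realType) (n : nat) (a p q r : R)
    (hn : (2 <= n)%N) (ha0 : 0 < a) (ha1 : a <= 1)
    (hp : 1 <= p) (hq : 1 <= q) (hr : 0 < r)
    (hexp : a / p + (1 - a) / q - a / n%:R <= 1 / r) :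
  ereal_inf [set CKN_quotient a p q r u | u in
    [set u : 'rV[R]_n -> R | Cc_infty [set~ 0] u /\ exists x, u x != 0]] = 0%E.
Proof.
have n0 : (0 < n)%N by exact: ltnW.
have p0 : 0 < p by exact: lt_le_trans hp.
have q0 : 0 < q by exact: lt_le_trans hq.
have [A A0 HA] := @integral_gradient_le R n p p0.
have [B B0 HB] := @integral_log_bump_le R n q q0.
have [D D0 HD] := @integral_log_bump_ge R n n0 r hr.
have [D' D'0 HD'] := @integral_log_bump_le R n r hr.
apply/eqP; rewrite eq_le; apply/andP; split; last first.
  apply: le_ereal_inf_tmp => _ [u _ <-]; rewrite /CKN_quotient.
  by rewrite mule_ge0 ?inve_ge0 ?poweR_ge0// mule_ge0// poweR_ge0.
apply/lee_addgt0Pr => e e0; rewrite add0e.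
pose C := A `^ (a / p) * B `^ ((1 - a) / q) / D `^ r^-1.
(* The total exponent of K once the three integrals are replaced by their bounds in K^(1-p), K and
   K. *)
pose E := (1 - p) * (a / p) + (1 - a) / q - r^-1.
have C0 : 0 < C by rewrite !mulr_gt0 ?invr_gt0 ?powR_gt0.
have E0 : E < 0.
  have -> : E = a / p + (1 - a) / q - a - r^-1.
    by rewrite /E; field; rewrite (gt_eqF p0) (gt_eqF q0) (gt_eqF hr).
  (* Strict because n >= 2 and a > 0; the hypothesis on the exponents gives E <= a/n - a. *)
  have : a / n%:R < a.
    by rewrite ltr_pdivrMr ?ltr0n// ltr_pMr// ltr1n.
  by move: hexp; rewrite div1r; lra.
have [K /andP[nK K0] CK] := @exists_nat_powR_le R (2 * n) C e E C0 e0 E0.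
apply: ge_ereal_inf.
exists (CKN_quotient a p q r (log_bump (2 * (K%:R * ln 2)) : 'rV[R]_n -> R)).
  exists (log_bump (2 * (K%:R * ln 2))) => //; split.
    exact: log_bump_Cc.
  exact: log_bump_neq0.
have KR : 0 < K%:R :> R by rewrite ltr0n.
have int_ge0 (f : 'rV[R]_n -> R) : (forall x, 0 <= f x) ->
    (0 <= \int[lebesgue_rV n]_x (f x)%:E)%E.
  by move=> f0; apply: integral_ge0 => x _; rewrite lee_fin.
apply: le_trans.
  apply: (@poweR_quotient_le R _ _ _ (A * K%:R `^ (1 - p)) (B * K%:R) (D * K%:R)
    (D' * K%:R) (a / p) ((1 - a) / q) r^-1).
  - by rewrite divr_ge0// ltW.
  - by rewrite divr_ge0 ?subr_ge0// ltW.
  - by rewrite invr_ge0 ltW.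
  - by rewrite mulr_gt0.
  - by rewrite (HA K K0) andbT int_ge0// => x; rewrite mulr_ge0 ?powR_ge0.
  - by rewrite (HB K K0) andbT int_ge0// => x; rewrite mulr_ge0 ?powR_ge0.
  - by rewrite (HD K nK K0) (HD' K K0).
rewrite lee_fin; apply: le_trans CK; rewrite le_eqVlt; apply/orP; left; apply/eqP.
rewrite /C /E !powRM ?powR_ge0 ?(ltW KR) ?(ltW A0) ?(ltW B0) ?(ltW D0)//.
rewrite -powRrM !powRD ?(gt_eqF KR) ?implybT// powRN.
by field; rewrite !gt_eqF ?powR_gt0.
Qed.
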